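(* Let $m\ge 2$, $1\le\ell\le m$, let $F=(f_1,\dots,f_\ell)$ be a bent vectorial function from $\mathrm{GF}(2^{2m})$ to $\mathrm{GF}(2)^\ell$, and let $\mathbf{D}$ be the design (with parameters $2$-$(2^{2m},2^{2m-1}-2^{m-1},(2^\ell-1)(2^{2m-2}-2^{m-1}))$) whose points are the $2^{2m}$ coordinate positions and whose blocks are the supports of the minimum-weight codewords of $\mathcal{C}(f_1,\dots,f_\ell)$. (a) If $\ell=1$, $\mathbf{D}$ is a symmetric SDP design, with any two distinct blocks meeting in $2^{2m-2}-2^{m-1}$ points. (b) If $2\le\ell\le m$, any two distinct blocks of $\mathbf{D}$ meet in $s_1=2^{2m-2}-2^{m-2}$, $s_2=2^{2m-2}-2^{m-1}$ or $s_3=2^{2m-2}-3\cdot2^{m-2}$ points, and for every block $B$ of $\mathbf{D}$, the numbers of other blocks meeting $B$ in $s_1,s_2,s_3$ points are respectively $n_1=2^m(2^m+1)(2^{\ell-1}-1)$, $n_2=2^{2m}-1$, $n_3=2^m(2^m-1)(2^{\ell-1}-1)$.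
   Context: Write $\mathrm{GF}(2^{2m})=\{u_1,\dots,u_q\}$, $q=2^{2m}$, and let $\mathrm{tr}_{2m/1}$ be the absolute trace to $\mathrm{GF}(2)$. A Boolean function $f:\mathrm{GF}(2^{2m})\to\mathrm{GF}(2)$ is bent if $\left|\sum_{x}(-1)^{f(x)+\mathrm{tr}_{2m/1}(wx)}\right|=2^m$ for all $w$. $F=(f_1,\dots,f_\ell)$ is a bent vectorial function if $\sum_j a_jf_j$ is bent for every nonzero $(a_1,\dots,a_\ell)\in\mathrm{GF}(2)^\ell$. The truth table of $f$ is $(f(u_1),\dots,f(u_q))$. $\mathrm{RM}_2(1,2m)=\{(\mathrm{tr}_{2m/1}(bu_i)+c)_{i=1}^q:b\in\mathrm{GF}(2^{2m}),c\in\mathrm{GF}(2)\}$, and $\mathcal{C}(f_1,\dots,f_\ell)$ is the binary linear code spanned by $\mathrm{RM}_2(1,2m)$ and the truth tables of $f_1,\dots,f_\ell$; its minimum weight is $2^{2m-1}-2^{m-1}$. A symmetric design is a $2$-design with as many blocks as points; a symmetric $2$-design is an SDP design (has the symmetric difference property) if the symmetric difference of any three blocks is either a block or the complement of a block. *)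

(* Defs.v *)
From HB Require Import structures.
From mathcomp Require Export all_boot all_order all_fingroup all_algebra all_field.

Set Implicit Arguments.
Unset Strict Implicit.
Unset Printing Implicit Defensive.

Import GRing.Theory Num.Theory.
Local Open Scope ring_scope.

Section Bent.

Variable K : finFieldType.

(* x + x^2 + ... + x^(2^(n-1)), read as an element of GF(2). The default 0 of
   [odflt] is never used when #|K| = 2 ^ n, see [abs_traceE]. *)
Definition abs_trace (n : nat) (x : K) : 'F_2 :=
  odflt 0 [pick c : 'F_2 | (nat_of_ord c)%:R == \sum_(i < n) x ^+ (2 ^ i)].

Lemma abs_traceE (n : nat) (x : K) : #|K| = (2 ^ n)%N ->
  (nat_of_ord (abs_trace n x))%:R = \sum_(i < n) x ^+ (2 ^ i).
Proof.
move=> cardK; set S := \sum_(i < n) _.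
have n_gt0 : (0 < n)%N.
  by rewrite lt0n; apply/eqP => n0; have := finNzRing_gt1 K; rewrite cardK n0.
have ch2 : 2%N \in [pchar K] := card_finPcharP cardK isT.
have sqS : S ^+ 2 = S.
  rewrite -(pFrobenius_autE ch2) rmorph_sum /= /S.
  under eq_bigr => i _ do rewrite pFrobenius_autE -exprM -expnSr.
  have xq : x ^+ (2 ^ n) = x by rewrite -cardK expf_card.
  case: n n_gt0 cardK S xq => // n _ _ _ xq.
  by rewrite big_ord_recr /= xq big_ord_recl /= expr1 addrC.
rewrite /abs_trace; case: pickP => [c /eqP //|noc].
have /eqP : S * (S - 1) = 0 by rewrite mulrBr mulr1 -expr2 sqS subrr.
rewrite mulf_eq0 subr_eq0 => /orP[/eqP S0 | /eqP S1].
  by have := noc 0; rewrite -/S S0 eqxx.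
by have := noc 1; rewrite -/S S1 eqxx.
Qed.

Definition bent (m : nat) (g : K -> 'F_2) : Prop :=
  forall w : K,
    `|\sum_(x : K) (-1 : int) ^+ nat_of_ord (g x + abs_trace (2 * m) (w * x))|
      = 2 ^+ m.

Definition bent_vectorial (m l : nat) (f : 'I_l -> K -> 'F_2) : Prop :=
  forall a : 'rV['F_2]_l, a != 0 ->
    bent m (fun x => \sum_(j < l) a 0 j * f j x).

(* In the next three definitions u lists the elements of K and so fixes which
   field element labels each coordinate position. *)

Definition truth_table (q : nat) (u : 'I_q -> K) (g : K -> 'F_2) :
  'rV['F_2]_q := \row_(i < q) g (u i).

Definition RM1 (m q : nat) (u : 'I_q -> K) : {set 'rV['F_2]_q} :=
  [set \row_(i < q) (abs_trace (2 * m) (b * u i) + c) | b : K, c : 'F_2].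

Definition bent_code (m q l : nat) (u : 'I_q -> K) (f : 'I_l -> K -> 'F_2) :
  {vspace 'rV['F_2]_q} :=
  <<enum (RM1 m u) ++ [seq truth_table u (f j) | j <- enum 'I_l]>>%VS.

End Bent.

Section Codes.

Variable q : nat.

Definition word_support (c : 'rV['F_2]_q) : {set 'I_q} :=
  [set i | c 0 i != 0].

Definition word_weight (c : 'rV['F_2]_q) : nat := #|word_support c|.

Definition min_weight_word (C : {vspace 'rV['F_2]_q}) (c : 'rV['F_2]_q) : bool :=
  [&& c \in C, c != 0 &
    [forall c' : 'rV['F_2]_q,
      (c' \in C) && (c' != 0) ==> (word_weight c <= word_weight c')%N]].

Definition min_weight_blocks (C : {vspace 'rV['F_2]_q}) : {set {set 'I_q}} :=
  [set word_support c | c in [pred c | min_weight_word C c]].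

End Codes.

Section Designs.

Local Open Scope nat_scope.

Variable P : finType.

Definition is_design (t v k lambda : nat) (D : {set {set P}}) : Prop :=
  [/\ #|P| = v, 0 < t, t <= k <= v,
      forall B, B \in D -> #|B| = k &
      forall T : {set P}, #|T| = t ->
        #|[set B in D | T \subset B]| = lambda].

Definition symmetric_design (D : {set {set P}}) : Prop :=
  (exists k lambda : nat, is_design 2 #|P| k lambda D) /\ #|D| = #|P|.

Definition symdiff (A B : {set P}) : {set P} := (A :\: B) :|: (B :\: A).

Definition SDP_design (D : {set {set P}}) : Prop :=
  symmetric_design D /\
  forall B1 B2 B3 : {set P}, B1 \in D -> B2 \in D -> B3 \in D ->
    let S := symdiff (symdiff B1 B2) B3 in S \in D \/ ~: S \in D.

End Designs.

(* Main.v *)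
(* For nonzero a and any b, bentness makes the sign sum of
   a.f(x) + tr(bx) + c equal to 2^m for exactly one constant c and to -2^m for
   the other, whereas nonzero affine words have sign sum 0 or -2^(2m).  As a
   word of sign sum S has weight (2^(2m) - S)/2, the blocks correspond
   bijectively to the pairs (a, b) with a nonzero.  Two blocks with words v, w
   meet in (2^(2m) - 2^(m+1) + S(v + w))/4 points, and S(v + w) is 0 when the
   two a's agree and 2^m or -2^m otherwise.  All counting then reduces to sums
   over b for fixed a: orthogonality of the characters tr(b.) shows that the
   signs of the blocks over a sum to 2^m at each point, and that their products
   at two distinct points sum to 0. *)

Require Import Defs.
From mathcomp Require Import zify ring.

Set Implicit Arguments.
Unset Strict Implicit.
Unset Printing Implicit Defensive.

Import Order.TTheory GRing.Theory Num.Theory.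

(** * Signs of bits and sign sums of binary words *)

Section SignSums.

Local Open Scope ring_scope.

Definition sgn2 (c : 'F_2) : int := (-1) ^+ nat_of_ord c.

Lemma F2P (c : 'F_2) : c = 0 \/ c = 1.
Proof.
by case: c => [[|[|//]]] ?; [left | right]; apply: val_inj.
Qed.

Lemma addF2 (c : 'F_2) : c + c = 0.
Proof. by case: (F2P c) => ->; apply: val_inj. Qed.

Lemma sgn2E (c : 'F_2) : sgn2 c = 1 - 2 * (c != 0)%:R.
Proof. by case: (F2P c) => ->. Qed.

Lemma sgn2D (c d : 'F_2) : sgn2 (c + d) = sgn2 c * sgn2 d.
Proof. by case: (F2P c) => ->; case: (F2P d) => ->. Qed.

Lemma sgn2_sq (c : 'F_2) : sgn2 c * sgn2 c = 1.
Proof. by rewrite -sgn2D addF2. Qed.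

Lemma sgn2_norm (c : 'F_2) : `|sgn2 c| = 1.
Proof. by case: (F2P c) => ->. Qed.

Variable q : nat.
Implicit Types v w : 'rV['F_2]_q.

Definition sign_sum w : int := \sum_i sgn2 (w 0 i).

Lemma addw_self w : w + w = 0.
Proof. by apply/rowP => i; rewrite !mxE addF2. Qed.

Lemma sum_nat_bool (I : finType) (P : pred I) :
  \sum_i (P i)%:R = (#|[set i | P i]|)%:Z.
Proof.
rewrite -sum1dep_card -natz natr_sum [RHS]big_mkcond /=.
by apply: eq_bigr => i _; case: (P i).
Qed.

(** Through this relation, minimising the weight amounts to maximising the sign sum. *)
Lemma sign_sumE w : sign_sum w = q%:Z - 2 * (word_weight w)%:Z.
Proof.
rewrite /sign_sum; under eq_bigr => i _ do rewrite sgn2E.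
by rewrite sumrB -mulr_sumr sum_nat_bool sumr_const card_ord (natz q).
Qed.

(** At each position, 4 times the indicator of both entries being nonzero is (1 - s)(1 - t), with s
    and t the signs of the entries, and s * t is the sign of their sum. *)
Lemma card_supportI v w :
  4 * (#|word_support v :&: word_support w|)%:Z
    = q%:Z - sign_sum v - sign_sum w + sign_sum (v + w).
Proof.
have -> : word_support v :&: word_support w
    = [set i | (v 0 i != 0) && (w 0 i != 0)].
  by apply/setP => i; rewrite !inE.
rewrite -sum_nat_bool mulr_sumr.
have -> : q%:Z = \sum_(i < q) 1 by rewrite sumr_const card_ord (natz q).
rewrite -!sumrB -big_split /=; apply: eq_bigr => i _; rewrite mxE.
by case: (F2P (v 0 i)) => ->; case: (F2P (w 0 i)) => ->.
Qed.

Lemma word_support_inj : injective (@word_support q).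
Proof.
move=> v w vw; apply/rowP => i; have /setP/(_ i) := vw; rewrite !inE.
by case: (F2P (v 0 i)) => ->; case: (F2P (w 0 i)) => ->.
Qed.

Lemma word_supportD v w :
  word_support (v + w) = symdiff (word_support v) (word_support w).
Proof.
apply/setP => i; rewrite !inE mxE.
by case: (F2P (v 0 i)) => ->; case: (F2P (w 0 i)) => ->.
Qed.

Lemma word_supportC w : word_support (w + const_mx 1) = ~: word_support w.
Proof.
by apply/setP => i; rewrite !inE !mxE; case: (F2P (w 0 i)) => ->.
Qed.

End SignSums.

(** * The absolute trace and orthogonality of its characters *)

Section Trace.

Local Open Scope ring_scope.

Variables (K : finFieldType) (n : nat).
Hypothesis hK : #|K| = (2 ^ n)%N.

Local Notation tr := (@abs_trace K n).

Let ch2 : 2%N \in [pchar K] := card_finPcharP hK isT.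

Lemma addK2 (x : K) : x + x = 0.
Proof. exact: addrr_pchar2. Qed.

Lemma addK2_eq0 (x y : K) : (x + y == 0) = (x == y).
Proof. by rewrite -(inj_eq (addIr y)) -addrA addK2 addr0 add0r. Qed.

(** Allows identities between traces to be checked in [K], where [abs_traceE] gives the power
    sum. *)
Lemma F2_natr_inj : injective (fun c : 'F_2 => (nat_of_ord c)%:R : K).
Proof.
move=> c d /=; case: (F2P c) => ->; case: (F2P d) => -> //= /eqP.
- by rewrite eq_sym oner_eq0.
- by rewrite oner_eq0.
Qed.

Lemma F2_natrD (c d : 'F_2) :
  (nat_of_ord (c + d))%:R = (nat_of_ord c)%:R + (nat_of_ord d)%:R :> K.
Proof.
case: (F2P c) => ->; case: (F2P d) => ->; rewrite /= ?addr0 ?add0r //.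
by rewrite addK2.
Qed.

Lemma abs_traceD (x y : K) : tr (x + y) = tr x + tr y.
Proof.
apply: F2_natr_inj; rewrite /= F2_natrD !abs_traceE // -big_split /=.
apply: eq_bigr => i _; apply: exprDn_pchar.
by rewrite (eq_pnat _ (pcharf_eq ch2)) pnatX pnat_id.
Qed.

Lemma abs_trace0 : tr 0 = 0.
Proof. by apply: (addrI (tr 0)); rewrite -abs_traceD !addr0. Qed.

(* The trace is a polynomial of degree 2^(n-1), too small to vanish on K. *)
Lemma abs_trace_neq0 : exists x : K, tr x = 1.
Proof.
case: (boolP [exists x, tr x != 0]) => [/existsP[x] | /existsPn tr0].
  by case: (F2P (tr x)) => trx; [rewrite trx | exists x].
have n_gt0 : (0 < n)%N.
  by rewrite lt0n; apply/eqP => n0; have := finNzRing_gt1 K; rewrite hK n0.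
case: n n_gt0 hK tr0 => // k _ hk tr0.
pose p : {poly K} := \sum_(i < k.+1) 'X^(2 ^ i).
have sp : size p = (2 ^ k).+1.
  rewrite /p big_ord_recr /= addrC size_polyDl ?size_polyXn //.
  apply: leq_ltn_trans (size_sum _ _ _) _; rewrite ltnS.
  by apply/bigmax_leqP => i _; rewrite size_polyXn ltn_exp2l.
have p0 : p != 0 by rewrite -size_poly_gt0 sp.
have rp : all (root p) (enum K).
  apply/allP => x _; rewrite rootE horner_sum.
  under eq_bigr => i _ do rewrite hornerXn.
  by rewrite -(abs_traceE x hk); have := tr0 x; rewrite negbK => /eqP ->.
have := max_poly_roots p0 rp (enum_uniq _).
by rewrite -cardE hk sp ltnS leq_exp2l // ltnn.
Qed.

Lemma sum_sgn2_trace (x : K) :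
  \sum_b sgn2 (tr (b * x)) = if x == 0 then (2 ^ n)%N%:Z else 0.
Proof.
case: eqP => [-> | /eqP x0].
  under eq_bigr => b _ do rewrite mulr0 abs_trace0.
  by rewrite sumr_const -hK natz.
have [y try] := abs_trace_neq0.
set S := \sum_b _.
(* Translating b by y / x adds tr y = 1 to the argument and so flips every sign. *)
suff : S = - S by lia.
rewrite {1}/S (reindex_inj (addIr (y / x))) /= -sumrN; apply: eq_bigr => b _.
by rewrite mulrDl divfK // abs_traceD try sgn2D mulrN1.
Qed.

End Trace.

(** * The words of the bent code and their sign sums *)

Section BentCode.

Local Open Scope ring_scope.

Variables (m l : nat) (K : finFieldType).
Variables (u : 'I_(2 ^ (2 * m)) -> K) (f : 'I_l -> K -> 'F_2).
Hypotheses (m_gt1 : (1 < m)%N) (l_gt0 : (0 < l)%N).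
Hypotheses (hK : #|K| = (2 ^ (2 * m))%N) (hu : bijective u).
Hypothesis hf : bent_vectorial m f.

Local Notation q := (2 ^ (2 * m))%N.
Local Notation tr := (@abs_trace K (2 * m)).
Local Notation C := (bent_code m u f).
Local Notation D := (min_weight_blocks C).

Implicit Types (a : 'rV['F_2]_l) (b : K) (c : 'F_2).

Definition lincomb a (x : K) : 'F_2 := \sum_(j < l) a 0 j * f j x.

Definition codeword a b c : 'rV['F_2]_q :=
  \row_i (lincomb a (u i) + tr (b * u i) + c).

Lemma lincombD a a' x : lincomb (a + a') x = lincomb a x + lincomb a' x.
Proof.
rewrite -big_split /=; apply: eq_bigr => j _.
by rewrite mxE mulrDl.
Qed.

Lemma codewordD a b c a' b' c' :
  codeword a b c + codeword a' b' c' = codeword (a + a') (b + b') (c + c').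
Proof.
apply/rowP => i; rewrite !mxE lincombD mulrDl abs_traceD //.
ring.
Qed.

Lemma codeword0 : codeword 0 0 0 = 0.
Proof.
apply/rowP => i; rewrite !mxE mul0r abs_trace0 // !addr0.
by apply: big1 => j _; rewrite mxE mul0r.
Qed.

Lemma bent_codeP (w : 'rV['F_2]_q) :
  reflect (exists a b c, w = codeword a b c) (w \in C).
Proof.
apply: (iffP idP) => [|[a [b [c ->]]]].
  pose X := in_tuple (enum (RM1 m u)
    ++ [seq truth_table u (f j) | j <- enum 'I_l]).
  move/(@coord_span _ _ _ X) => ->.
  apply: (big_ind (fun v => exists a b c, v = codeword a b c)).
  - by exists 0, 0, 0; rewrite codeword0.
  - by move=> _ _ [a [b [c ->]]] [a' [b' [c' ->]]]; rewrite codewordD;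
      do 3 eexists.
  move=> i _; case: (F2P (coord X i w)) => ->.
    by exists 0, 0, 0; rewrite codeword0 scale0r.
  rewrite scale1r.
  have : X`_i \in X by rewrite mem_nth // size_tuple.
  rewrite mem_cat => /orP[|/mapP[j _ ->]].
    rewrite mem_enum => /imset2P[b c _ _ ->]; exists 0, b, c.
    apply/rowP => k; rewrite !mxE [lincomb _ _]big1 ?add0r // => j _.
    by rewrite mxE mul0r.
  (* The truth table of f_j is the combination with the unit vector at j and zero affine part. *)
  exists (delta_mx 0 j), 0, 0; apply/rowP => k.
  rewrite !mxE mul0r abs_trace0 // !addr0 /lincomb (bigD1 j) //= mxE !eqxx.
  rewrite mul1r big1 ?addr0 // => j' jj'.
  by rewrite mxE eqxx (negPf jj') mul0r.
have -> : codeword a b c = \sum_j a 0 j *: truth_table u (f j)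
    + \row_i (tr (b * u i) + c).
  apply/rowP => i; rewrite !mxE summxE addrA; congr (_ + _ + _).
  by apply: eq_bigr => j _; rewrite !mxE.
apply: rpredD.
  apply: rpred_sum => j _; apply: rpredZ; apply: memv_span.
  by rewrite mem_cat map_f ?orbT // mem_enum.
by apply: memv_span; rewrite mem_cat mem_enum; apply/orP; left; apply: imset2_f.
Qed.

Lemma sign_sum_codeword a b c :
  sign_sum (codeword a b c) = sgn2 c * \sum_x sgn2 (lincomb a x + tr (b * x)).
Proof.
rewrite mulr_sumr [RHS](reindex u) /=; last exact: onW_bij.
by apply: eq_bigr => i _; rewrite mxE sgn2D mulrC.
Qed.

Lemma sign_sum_bent a b c : a != 0 ->
  `|sign_sum (codeword a b c)| = 2 ^+ m.
Proof.
by move=> a0; rewrite sign_sum_codeword normrM sgn2_norm mul1r; apply: hf.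
Qed.

(** With a = 0 only a character sum over x remains, and orthogonality evaluates it. *)
Lemma sign_sum_affine b c :
  sign_sum (codeword 0 b c) = if b == 0 then sgn2 c * q%:Z else 0.
Proof.
rewrite sign_sum_codeword.
have -> : \sum_x sgn2 (lincomb 0 x + tr (b * x)) = \sum_x sgn2 (tr (x * b)).
  apply: eq_bigr => x _; rewrite mulrC [lincomb _ _]big1 ?add0r // => j _.
  by rewrite mxE mul0r.
by rewrite sum_sgn2_trace //; case: eqP => _; rewrite ?mulr0.
Qed.

Lemma pow2m_gt0 : 0 < 2 ^+ m :> int.
Proof. by rewrite exprn_gt0. Qed.

Lemma q_sq : q%:Z = 2 ^+ m * 2 ^+ m.
Proof. by rewrite -exprD addnn -mul2n -natz natrX. Qed.

Lemma sign_sum_bentP a b c : a != 0 ->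
  sign_sum (codeword a b c) = 2 ^+ m \/ sign_sum (codeword a b c) = - 2 ^+ m.
Proof. by move/(sign_sum_bent b c); have := pow2m_gt0; lia. Qed.

Lemma sign_sum0 : sign_sum (0 : 'rV['F_2]_q) = q%:Z.
Proof.
rewrite /sign_sum; under eq_bigr => i _ do rewrite mxE.
by rewrite sumr_const card_ord natz.
Qed.

Lemma pow2m_lt_q : 2 ^+ m < q%:Z.
Proof.
rewrite q_sq ltr_pMr ?pow2m_gt0 // exprn_egt1 //; lia.
Qed.

(** The zero word has sign sum 2^(2m), whereas other parameters give 2^m or -2^m (a nonzero), 0 (a =
    0, b nonzero) or -2^(2m) (only c nonzero). Hence a word determines its parameters. *)
Lemma codeword_eq0 a b c : codeword a b c = 0 -> [/\ a = 0, b = 0 & c = 0].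
Proof.
have q2 := pow2m_lt_q; have m0 := pow2m_gt0.
move=> w0; have := sign_sum0; rewrite -w0.
have [a0 | a0] := eqVneq a 0; last first.
  by move=> wq; have := sign_sum_bent b c a0; rewrite wq; lia.
rewrite a0 sign_sum_affine; have [-> | _] := eqVneq b 0; last by lia.
by case: (F2P c) => -> // cq; exfalso; move: cq; rewrite mulN1r; lia.
Qed.

Lemma codeword_inj a b c a' b' c' :
  codeword a b c = codeword a' b' c' -> [/\ a = a', b = b' & c = c'].
Proof.
move=> ww; have := addw_self (codeword a b c); rewrite {2}ww codewordD.
case/codeword_eq0 => aa /eqP bb cc; split.
- by apply: (addIr a'); rewrite aa addw_self.
- by apply/eqP; rewrite -(addK2_eq0 hK).
- by apply: (addIr c'); rewrite cc addF2.
Qed.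

(* The value at b of the dual of the bent function a.f. *)
Definition dual_const a b : 'F_2 :=
  if sign_sum (codeword a b 0) == 2 ^+ m then 0 else 1.

Definition light_word (p : 'rV['F_2]_l * K) : 'rV['F_2]_q :=
  codeword p.1 p.2 (dual_const p.1 p.2).

Definition block p : {set 'I_q} := word_support (light_word p).

(** The sum with constant 0 is 2^m or -2^m, and in the second case passing to constant 1 negates
    it. *)
Lemma sign_sum_light p : p.1 != 0 -> sign_sum (light_word p) = 2 ^+ m.
Proof.
case: p => a b /= a0; rewrite /light_word /dual_const /=; case: eqP => // n.
have := sign_sum_bentP b 0 a0; move: n.
by rewrite !sign_sum_codeword mul1r mulN1r; lia.
Qed.

Lemma sign_sum_eq_light a b c : a != 0 ->
  sign_sum (codeword a b c) = 2 ^+ m -> codeword a b c = light_word (a, b).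
Proof.
move=> a0 S; congr codeword; move: S; rewrite /dual_const.
case: (F2P c) => -> S; first by rewrite S eqxx.
case: eqP S => // ; rewrite !sign_sum_codeword mul1r mulN1r => ->.
by have := pow2m_gt0; lia.
Qed.

(** * Minimum-weight words and the parametrization of the blocks *)

Lemma sign_sum_code_le w : w \in C -> w != 0 ->
  sign_sum w <= 2 ^+ m ?= iff [exists p, (p.1 != 0) && (w == light_word p)].
Proof.
have m0 := pow2m_gt0; have q2 := pow2m_lt_q.
case/bent_codeP => a [b [c ->]] w0.
suff [Slt | [p p0 ->]] : sign_sum (codeword a b c) < 2 ^+ m
    \/ exists2 p, p.1 != 0 & codeword a b c = light_word p.
- split; first exact: ltW.
  rewrite lt_eqF //; apply/esym/existsP => -[p /andP[p0 /eqP wp]].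
  by move: Slt; rewrite wp sign_sum_light // ltxx.
- rewrite sign_sum_light //; split; rewrite ?eqxx //.
  by apply/esym/existsP; exists p; rewrite p0 eqxx.
have [a0 | a0] := eqVneq a 0.
  left; move: w0; rewrite a0 sign_sum_affine; have [->|//] := eqVneq b 0.
  case: (F2P c) => ->; first by rewrite codeword0 eqxx.
  by rewrite mulN1r; lia.
have [S | S] := sign_sum_bentP b c a0; last by left; lia.
by right; exists (a, b) => //; apply: sign_sum_eq_light.
Qed.

Lemma light_word_code p : light_word p \in C.
Proof. by apply/bent_codeP; do 3 eexists. Qed.

Lemma light_word_neq0 p : p.1 != 0 -> light_word p != 0.
Proof. by move=> p0; apply/eqP => /codeword_eq0[/eqP]; rewrite (negPf p0). Qed.

Lemma min_weight_wordE w :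
  min_weight_word C w = [exists p, (p.1 != 0) && (w == light_word p)].
Proof.
apply/and3P/existsP => [[wC w0 /forallP minw]|[p /andP[p0 /eqP ->]]].
  (* Any light word serves as the competitor; the all-one vector is nonzero because l > 0. *)
  pose p0 : 'rV['F_2]_l * K := (const_mx 1, 0).
  have p00 : p0.1 != 0.
    apply/eqP => /rowP/(_ (Ordinal l_gt0)); rewrite !mxE => /eqP.
    by rewrite oner_eq0.
  have := minw (light_word p0).
  rewrite light_word_code light_word_neq0 //= => wle.
  have S0 := sign_sum_light p00; have [Sle Seq] := sign_sum_code_le wC w0.
  apply/existsP; rewrite -Seq; apply/eqP.
  by move: S0 Sle; rewrite !sign_sumE; lia.
split; [exact: light_word_code | exact: light_word_neq0 |].
apply/forallP => v; apply/implyP => /andP[vC v0].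
have [Sle _] := sign_sum_code_le vC v0.
by move: Sle; rewrite -(sign_sum_light p0) !sign_sumE; lia.
Qed.

Lemma blocksE : D = block @: [set p | p.1 != 0].
Proof.
apply/setP => B; apply/imsetP/imsetP => [[w]|[p]]; rewrite inE.
  rewrite min_weight_wordE => /existsP[p /andP[p0 /eqP ->]] ->.
  by exists p; rewrite ?inE.
move=> p0 ->; exists (light_word p) => //; rewrite inE min_weight_wordE.
by apply/existsP; exists p; rewrite p0 eqxx.
Qed.

Lemma block_inj : injective block.
Proof.
by move=> [a b] [a' b'] /word_support_inj/codeword_inj[/= -> -> _].
Qed.

(** Reduces every count of blocks to counts over b for each fixed nonzero a. *)
Lemma card_blocks (P : pred {set 'I_q}) :
  #|[set B in D | P B]| = (\sum_(a | a != 0%R) #|[set b | P (block (a, b))]|)%N.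
Proof.
have -> : [set B in D | P B] = block @: [set p | (p.1 != 0) && P (block p)].
  apply/setP => B; rewrite inE blocksE.
  apply/andP/imsetP => [[/imsetP[p]]|[p]]; rewrite inE.
    by move=> p0 -> PB; exists p; rewrite // inE p0.
  by case/andP => p0 PB ->; split=> //; apply: imset_f; rewrite inE.
rewrite card_imset; last exact: block_inj.
rewrite -sum1dep_card -(pair_big_dep (fun a => a != 0)
  (fun a b => P (block (a, b))) (fun _ _ => 1%N)) /=.
by apply: eq_bigr => a _; rewrite sum1dep_card.
Qed.

(** * Character sums over the blocks with fixed a *)

Lemma sgn2_dual_const a b : a != 0 ->
  2 ^+ m * sgn2 (dual_const a b) = sign_sum (codeword a b 0).
Proof.
move=> a0; have := sign_sum_light (p := (a, b)) a0.
rewrite /light_word !sign_sum_codeword /= mul1r => <-.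
by rewrite mulrAC sgn2_sq mul1r.
Qed.

(** This is Fourier inversion: after multiplication by 2^m each dual sign becomes a Walsh sum over
    x, and summing over b keeps only x = u i, which contributes 2^(2m). *)
Lemma sum_light_point a (i : 'I_q) : a != 0 ->
  \sum_b sgn2 (light_word (a, b) 0 i) = 2 ^+ m.
Proof.
have m0 : 2 ^+ m != 0 :> int by rewrite gt_eqF ?pow2m_gt0.
move=> a0; apply: (mulfI m0).
rewrite -q_sq mulr_sumr.
transitivity (\sum_b \sum_x sgn2 (lincomb a (u i)) * sgn2 (lincomb a x)
    * sgn2 (tr (b * (u i + x)))).
  apply: eq_bigr => b _; rewrite mxE /= sgn2D mulrCA sgn2_dual_const //.
  rewrite sign_sum_codeword mul1r mulr_sumr; apply: eq_bigr => x _.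
  by rewrite mulrDr abs_traceD // !sgn2D; ring.
rewrite exchange_big /=.
under eq_bigr => x _ do rewrite -mulr_sumr sum_sgn2_trace // (addK2_eq0 hK).
rewrite (bigD1 (u i)) //= eqxx sgn2_sq mul1r big1 ?addr0 // => x xi.
by rewrite eq_sym (negPf xi) mulr0.
Qed.

(** The constant of each light word occurs twice and cancels, leaving the character sum at u i + u
    j, which is nonzero since [u] is injective. *)
Lemma sum_light_pair a (i j : 'I_q) : i != j ->
  \sum_b sgn2 (light_word (a, b) 0 i) * sgn2 (light_word (a, b) 0 j) = 0.
Proof.
move=> ij.
transitivity (\sum_b sgn2 (lincomb a (u i)) * sgn2 (lincomb a (u j))
    * sgn2 (tr (b * (u i + u j)))).
  apply: eq_bigr => b _; rewrite !mxE /= mulrDr abs_traceD // !sgn2D.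
  by rewrite -[RHS]mulr1 -(sgn2_sq (dual_const a b)); ring.
rewrite -mulr_sumr sum_sgn2_trace // (addK2_eq0 hK) (inj_eq (bij_inj hu)).
by rewrite (negPf ij) mulr0.
Qed.

Lemma sign_sum_lightD_eq a b b' : b != b' ->
  sign_sum (light_word (a, b) + light_word (a, b')) = 0.
Proof.
move=> bb; rewrite codewordD /= addw_self sign_sum_affine.
by rewrite (addK2_eq0 hK) (negPf bb).
Qed.

(** The sum is a codeword over a + a', which is nonzero, so the corresponding combination of the f_j
    is again bent. *)
Lemma sign_sum_lightD_neq a b a' b' : a != a' ->
  sign_sum (light_word (a, b) + light_word (a', b')) = 2 ^+ m \/
  sign_sum (light_word (a, b) + light_word (a', b')) = - 2 ^+ m.
Proof.
move=> aa; rewrite codewordD /=; apply: sign_sum_bentP.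
apply: contra_neq aa => aa; apply: (addIr a'); rewrite aa.
by rewrite addw_self.
Qed.

Lemma card_blockI p p' : p.1 != 0 -> p'.1 != 0 ->
  4 * (#|block p :&: block p'|)%:Z
    = q%:Z - 2 * 2 ^+ m + sign_sum (light_word p + light_word p').
Proof.
by move=> p0 p'0; rewrite card_supportI !sign_sum_light //; ring.
Qed.

(* The light words over a' sum to the constant 2^m at every position, so the
   sums of their products with a fixed light word add up to 2^m * 2^m. *)
Lemma card_sign_sum_light a b a' : a != 0 -> a' != 0 -> a != a' ->
  2 * (#|[set b' | sign_sum (light_word (a, b) + light_word (a', b'))
                     == 2 ^+ m]|)%:Z = q%:Z + 2 ^+ m.
Proof.
move=> a0 a'0 aa; have m0 := pow2m_gt0; rewrite -sum_nat_bool.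
have m_neq0 : 2 ^+ m != 0 :> int by rewrite gt_eqF.
apply: (mulfI m_neq0).
(* Each term is 2 * 2^m when the sign sum is 2^m and 0 when it is -2^m, so this sum counts the
   wanted b'. *)
have <- : \sum_b' (2 ^+ m
    + sign_sum (light_word (a, b) + light_word (a', b'))) = 2 ^+ m * (q%:Z + 2 ^+ m).
  rewrite big_split /= sumr_const hK -[_ *+ q]mulr_natr (natz q) mulrDr.
  congr (_ + _); rewrite /sign_sum exchange_big /=.
  transitivity (2 ^+ m * sign_sum (light_word (a, b))).
    rewrite mulr_sumr; apply: eq_bigr => i _.
    under eq_bigr => b' _ do rewrite mxE sgn2D.
    by rewrite -mulr_sumr sum_light_point // mulrC.
  by rewrite sign_sum_light.
rewrite !mulr_sumr; apply: eq_bigr => b' _.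
by case: (sign_sum_lightD_neq b b' aa) => ->; case: eqP => //; lia.
Qed.

(** Expand (1 - s)(1 - t) for the signs s, t at the two points: the linear terms sum to 2^m each and
    the products sum to 0. *)
Lemma card_blocks_two_points a (i j : 'I_q) : a != 0 -> i != j ->
  4 * (#|[set b | (i \in block (a, b)) && (j \in block (a, b))]|)%:Z
    = q%:Z - 2 * 2 ^+ m.
Proof.
move=> a0 ij; rewrite -sum_nat_bool mulr_sumr.
transitivity (\sum_b (1 - sgn2 (light_word (a, b) 0 i)
    - sgn2 (light_word (a, b) 0 j)
    + sgn2 (light_word (a, b) 0 i) * sgn2 (light_word (a, b) 0 j))).
  apply: eq_bigr => b _; rewrite !inE.
  by case: (F2P (light_word (a, b) 0 i)) => ->;
    case: (F2P (light_word (a, b) 0 j)) => ->.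
rewrite big_split /= !sumrB !sum_light_point // sum_light_pair //.
by rewrite sumr_const hK natz; ring.
Qed.

Lemma block_in p : p.1 != 0 -> block p \in D.
Proof. by move=> p0; rewrite blocksE imset_f // inE. Qed.

Lemma card_F2_neq0 : #|[pred a : 'rV['F_2]_l | a != 0]| = (2 ^ l - 1)%N.
Proof.
by rewrite (eq_card (B := predC1 0)) // cardC1 card_mx card_Fp // mul1n subn1.
Qed.

Lemma card_F2_neq0_neq a : a != 0 ->
  #|[pred a' | (a' != 0) && (a' != a)]| = (2 ^ l - 2)%N.
Proof.
move=> a0; have := cardD1 a [pred a' : 'rV['F_2]_l | a' != 0].
rewrite card_F2_neq0 inE a0 => e.
rewrite (eq_card (B := [predD1 [pred a' | a' != 0] & a])); last first.
  by move=> a'; rewrite !inE andbC.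
by rewrite -(addKn true #|_|) -e -subnDA.
Qed.

(** Splits the other blocks into those over the same a, counted by x, and those over the 2^l - 2
    other nonzero vectors, each of which contributes y. *)
Lemma card_meeting_blocks a b s x y : a != 0 ->
  #|[set b' | (b' != b) && (#|block (a, b) :&: block (a, b')| == s)]| = x ->
  (forall a', a' != 0 -> a' != a ->
    #|[set b' | #|block (a, b) :&: block (a', b')| == s]| = y) ->
  #|[set B' in D :\ block (a, b) | #|block (a, b) :&: B'| == s]|
    = (x + (2 ^ l - 2) * y)%N.
Proof.
move=> a0 hx hy.
have -> : [set B' in D :\ block (a, b) | #|block (a, b) :&: B'| == s]
    = [set B' in D | (B' != block (a, b)) && (#|block (a, b) :&: B'| == s)].
  by apply/setP => B'; rewrite !inE; do !case: (_ == _); do ?case: (_ \in _).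
rewrite card_blocks (bigD1 a) //= -hx; congr (_ + _)%N.
  apply: eq_card => b'; rewrite !inE (inj_eq block_inj) xpair_eqE eqxx //.
rewrite -(card_F2_neq0_neq a0) -sum_nat_const; apply: eq_big => // a'.
case/andP => a'0 aa; rewrite -(hy a') //; apply: eq_card => b'.
by rewrite !inE (inj_eq block_inj) xpair_eqE (negPf aa).
Qed.

(** * Block sizes, pairwise intersections and the design parameters *)

Local Notation M := (2 ^ (m - 2))%N.

(** Every power of two in the parameters becomes a multiple of M or M * M, so that [lia] can treat
    these two as atoms. *)
Lemma pow2_quarter :
  [/\ (2 ^ m = 4 * M)%N, (2 ^ (m - 1) = 2 * M)%N, q = (16 * (M * M))%N,
      (2 ^ (2 * m - 1) = 8 * (M * M))%N & (2 ^ (2 * m - 2) = 4 * (M * M))%N].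
Proof.
have -> : m = (m - 2).+2 by lia.
move: (m - 2)%N => k; rewrite (_ : k.+2 - 2 = k)%N; last by lia.
have -> : (k.+2 - 1 = k.+1)%N by lia.
have -> : (2 * k.+2 = (k + k).+4)%N by lia.
have -> : ((k + k).+4 - 1 = (k + k).+3)%N by lia.
have -> : ((k + k).+4 - 2 = (k + k).+2)%N by lia.
by rewrite !expnS !expnD; split; lia.
Qed.

Lemma pow2m_quarter : 2 ^+ m = (4 * M)%:Z.
Proof. by have [<- _ _ _ _] := pow2_quarter; rewrite -natz natrX. Qed.

(** These bounds keep the natural-number subtractions in the parameters from truncating. *)
Lemma quarter_gt0 : (0 < M <= M * M)%N.
Proof. by rewrite leq_pmulr expn_gt0. Qed.

Lemma card_block p : p.1 != 0 -> #|block p| = (2 ^ (2 * m - 1) - 2 ^ (m - 1))%N.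
Proof.
move=> /sign_sum_light; rewrite sign_sumE -/(block p) /word_weight -/(block p).
rewrite pow2m_quarter; have [m4 m2 q16 q8 q4] := pow2_quarter.
by have := quarter_gt0; lia.
Qed.

Lemma bent_code_design :
  is_design 2 q (2 ^ (2 * m - 1) - 2 ^ (m - 1))
    ((2 ^ l - 1) * (2 ^ (2 * m - 2) - 2 ^ (m - 1))) D.
Proof.
split=> //; first by rewrite card_ord.
- have [m4 m2 q16 q8 q4] := pow2_quarter; have := quarter_gt0; lia.
- move=> B; rewrite blocksE => /imsetP[p]; rewrite inE => p0 ->.
  exact: card_block.
move=> T /eqP/cards2P[i [j [ij ->]]].
(* Each of the 2^l - 1 nonzero a contributes the same number of blocks through i and j. *)
rewrite (card_blocks (fun B => [set i; j] \subset B)) -card_F2_neq0 -sum_nat_const.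
apply: eq_bigr => a a0.
have := card_blocks_two_points a0 ij; rewrite pow2m_quarter.
have -> : [set b | [set i; j] \subset block (a, b)]
    = [set b | (i \in block (a, b)) && (j \in block (a, b))].
  by apply/setP => b; rewrite !inE subUset !sub1set !inE.
have [m4 m2 q16 q8 q4] := pow2_quarter; have := quarter_gt0; set n := #|_|; lia.
Qed.

Lemma block_meet_eq a b b' : a != 0 -> b != b' ->
  #|block (a, b) :&: block (a, b')| = (2 ^ (2 * m - 2) - 2 ^ (m - 1))%N.
Proof.
move=> a0 bb; have := @card_blockI (a, b) (a, b') a0 a0.
rewrite sign_sum_lightD_eq // pow2m_quarter.
have [m4 m2 q16 q8 q4] := pow2_quarter; have := quarter_gt0; lia.
Qed.

Lemma block_meet_neq a b a' b' : a != 0 -> a' != 0 -> a != a' ->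
  #|block (a, b) :&: block (a', b')|
    = if sign_sum (light_word (a, b) + light_word (a', b')) == 2 ^+ m
      then (2 ^ (2 * m - 2) - M)%N else (2 ^ (2 * m - 2) - 3 * M)%N.
Proof.
move=> a0 a'0 aa; have := @card_blockI (a, b) (a', b') a0 a'0.
have [m4 m2 q16 q8 q4] := pow2_quarter; have := quarter_gt0.
case: eqP => [->|]; first by rewrite pow2m_quarter; lia.
by case: (sign_sum_lightD_neq b b' aa) => -> //; rewrite pow2m_quarter; lia.
Qed.

Lemma card_blocks_all : #|D| = ((2 ^ l - 1) * q)%N.
Proof.
rewrite -[D]setIT -setIdE (eq_card (B := [set B in D | xpredT B])); last first.
  by move=> B; rewrite !inE.
rewrite card_blocks -card_F2_neq0 -sum_nat_const; apply: eq_bigr => a _.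
by rewrite -hK -cardsT; apply: eq_card => b; rewrite !inE.
Qed.

(** * The case l = 1 and the symmetric difference property *)

Lemma nonzero_F2_unique a a' : l = 1%N -> a != 0 -> a' != 0 -> a = a'.
Proof.
move=> l1 a0 a'0; apply/eqP; apply: contraT; rewrite eq_sym => aa.
have l2 : (2 ^ l - 2 = 0)%N by rewrite l1.
have := card_F2_neq0_neq a0; rewrite l2 => /card0_eq/(_ a').
by rewrite inE a'0 aa.
Qed.

(** Since a + a + a = a, the three words add up to a codeword over a. If its sign sum is 2^m it is
    light; if it is -2^m, adding the all-one word makes it light and complements the support. *)
Lemma block_symdiff3 a b1 b2 b3 : a != 0 ->
  let S := symdiff (symdiff (block (a, b1)) (block (a, b2))) (block (a, b3)) in
  S \in D \/ ~: S \in D.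
Proof.
move=> a0 S.
have [b [c ->]] : exists b c, S = word_support (codeword a b c).
  rewrite /S -!word_supportD !codewordD /= addw_self add0r; by do 2 eexists.
have complE : codeword a b (c + 1) = codeword a b c + const_mx 1.
  have -> : const_mx 1 = codeword 0 0 1.
    apply/rowP => i; rewrite !mxE mul0r abs_trace0 // [lincomb _ _]big1 ?add0r //.
    by move=> j _; rewrite mxE mul0r.
  by rewrite codewordD !addr0.
have [S1 | S1] := sign_sum_bentP b c a0; [left | right].
  by rewrite (sign_sum_eq_light a0 S1) block_in.
rewrite -word_supportC -complE (@sign_sum_eq_light a b) ?block_in //.
by move: S1; rewrite !sign_sum_codeword sgn2D mulrN1 mulNr => ->; rewrite opprK.
Qed.

Lemma blocksP B : B \in D -> exists a b, a != 0 /\ B = block (a, b).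
Proof.
by rewrite blocksE => /imsetP[[a b]]; rewrite inE => ? ->; exists a, b.
Qed.

Lemma bent_code_SDP : l = 1%N ->
  SDP_design D /\
  (forall B B' : {set 'I_q}, B \in D -> B' \in D -> B != B' ->
     #|B :&: B'| = (2 ^ (2 * m - 2) - 2 ^ (m - 1))%N).
Proof.
move=> l1; split; last first.
  move=> _ _ /blocksP[a [b [a0 ->]]] /blocksP[a' [b' [a'0 ->]]].
  rewrite (nonzero_F2_unique l1 a'0 a0) => BB; apply: block_meet_eq => //.
  by apply: contra_neq BB => ->.
split; first split.
- by do 2 eexists; rewrite [in X in is_design _ X]card_ord; apply: bent_code_design.
- by rewrite card_blocks_all card_ord l1 mul1n.
move=> B1 B2 B3 /blocksP[a1 [b1 [a0 ->]]] /blocksP[a2 [b2 [a20 ->]]].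
case/blocksP=> a3 [b3 [a30 ->]].
rewrite (nonzero_F2_unique l1 a20 a0) (nonzero_F2_unique l1 a30 a0).
exact: block_symdiff3.
Qed.

(** * The three intersection sizes and their multiplicities *)

Lemma bent_code_block_meet B B' : B \in D -> B' \in D -> B != B' ->
  [\/ #|B :&: B'| = (2 ^ (2 * m - 2) - M)%N,
      #|B :&: B'| = (2 ^ (2 * m - 2) - 2 ^ (m - 1))%N |
      #|B :&: B'| = (2 ^ (2 * m - 2) - 3 * M)%N].
Proof.
move=> /blocksP[a [b [a0 ->]]] /blocksP[a' [b' [a'0 ->]]].
have [<- BB | aa _] := eqVneq a a'.
  constructor 2; apply: block_meet_eq => //.
  by apply: contra_neq BB => ->.
by rewrite block_meet_neq //; case: ifP; [constructor 1 | constructor 3].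
Qed.

Lemma bent_code_meet_numbers B : B \in D ->
  [/\ #|[set B' in D :\ B | #|B :&: B'| == 2 ^ (2 * m - 2) - M]%N|
        = (2 ^ m * (2 ^ m + 1) * (2 ^ (l - 1) - 1))%N,
      #|[set B' in D :\ B | #|B :&: B'| == 2 ^ (2 * m - 2) - 2 ^ (m - 1)]%N|
        = (q - 1)%N &
      #|[set B' in D :\ B | #|B :&: B'| == 2 ^ (2 * m - 2) - 3 * M]%N|
        = (2 ^ m * (2 ^ m - 1) * (2 ^ (l - 1) - 1))%N].
Proof.
case/blocksP=> a [b [a0 ->]].
have [m4 m2 q16 _ q4] := pow2_quarter; have M0 := quarter_gt0.
have l2 : (2 ^ l = 2 * 2 ^ (l - 1))%N by rewrite -expnS subn1 prednK.
(* Distinct blocks over the same a always meet in s2 points, so they contribute nothing to s1 or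
   s3. *)
have card0 s : (2 ^ (2 * m - 2) - 2 ^ (m - 1) != s)%N ->
    #|[set b' | (b' != b) && (#|block (a, b) :&: block (a, b')| == s)]| = 0%N.
  move=> ns; apply/eqP; rewrite cards_eq0; apply/eqP/setP => b'; rewrite !inE.
  rewrite [b' == b]eq_sym; have [//|bb] := eqVneq b b'.
  by rewrite block_meet_eq // (negPf ns).
pose N a' := #|[set b' | sign_sum (light_word (a, b) + light_word (a', b'))
                           == 2 ^+ m]|.
(* The value is (2^(2m) + 2^m) / 2 with 2^m = 4 * M. *)
have NE a' : a' != 0 -> a' != a -> N a' = (8 * (M * M) + 2 * M)%N.
  move=> a'0 aa; have := @card_sign_sum_light a b a' a0 a'0.
  by rewrite eq_sym aa -/(N a') pow2m_quarter => /(_ isT); lia.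
split.
- rewrite (@card_meeting_blocks _ _ _ 0 (8 * (M * M) + 2 * M)) //.
  + by rewrite m4 l2; have := expn_gt0 2 (l - 1); nia.
  + by apply: card0; lia.
  move=> a' a'0 aa; rewrite -(NE a') //; apply: eq_card => b'.
  rewrite !inE block_meet_neq ?[a == a']eq_sym //.
  by case: ifP => _; rewrite ?eqxx //; lia.
(* The size s2 occurs only over the same a, where all q - 1 other blocks have it. *)
- rewrite (@card_meeting_blocks _ _ _ (q - 1) 0) ?muln0 ?addn0 //.
    transitivity #|predC1 b|; last by rewrite cardC1 hK subn1.
    apply: eq_card => b'; rewrite !inE.
    rewrite [b' == b]eq_sym; have [//|bb] := eqVneq b b'.
    by rewrite block_meet_eq ?eqxx.
  move=> a' a'0 aa; apply/eqP; rewrite cards_eq0; apply/eqP/setP => b'.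
  rewrite !inE block_meet_neq ?[a == a']eq_sym //.
  by case: ifP => _; lia.
(* Over another a', the blocks meeting in s3 points are those not counted by [N], so their number is
   q - (8 * (M * M) + 2 * M). *)
rewrite (@card_meeting_blocks _ _ _ 0 (8 * (M * M) - 2 * M)) //.
- by rewrite m4 l2; have := expn_gt0 2 (l - 1); nia.
- by apply: card0; lia.
move=> a' a'0 aa.
have -> : [set b' | #|block (a, b) :&: block (a', b')|
                      == 2 ^ (2 * m - 2) - 3 * M]%N
  = ~: [set b' | sign_sum (light_word (a, b) + light_word (a', b')) == 2 ^+ m].
  apply/setP => b'; rewrite !inE block_meet_neq ?[a == a']eq_sym //.
  by case: ifP => _; rewrite ?eqxx //; lia.
by rewrite cardsCs setCK hK -/(N a') NE //; lia.
Qed.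

End BentCode.

Theorem theorem19 (m l : nat) (K : finFieldType)
    (u : 'I_(2 ^ (2 * m)) -> K) (f : 'I_l -> K -> 'F_2)
    (hm : 2 <= m) (hl : 1 <= l <= m)
    (hK : #|K| = 2 ^ (2 * m)) (hu : bijective u)
    (hf : bent_vectorial m f) :
  let D := min_weight_blocks (bent_code m u f) in
  [/\ is_design 2 (2 ^ (2 * m)) (2 ^ (2 * m - 1) - 2 ^ (m - 1))
        ((2 ^ l - 1) * (2 ^ (2 * m - 2) - 2 ^ (m - 1))) D,
      l = 1 ->
        SDP_design D /\
        (forall B B' : {set 'I_(2 ^ (2 * m))},
           B \in D -> B' \in D -> B != B' ->
           #|B :&: B'| = 2 ^ (2 * m - 2) - 2 ^ (m - 1)) &
      2 <= l ->
        let s1 := 2 ^ (2 * m - 2) - 2 ^ (m - 2) in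
        let s2 := 2 ^ (2 * m - 2) - 2 ^ (m - 1) in
        let s3 := 2 ^ (2 * m - 2) - 3 * 2 ^ (m - 2) in
        (forall B B' : {set 'I_(2 ^ (2 * m))},
           B \in D -> B' \in D -> B != B' ->
           [\/ #|B :&: B'| = s1, #|B :&: B'| = s2 | #|B :&: B'| = s3]) /\
        (forall B : {set 'I_(2 ^ (2 * m))}, B \in D ->
           [/\ #|[set B' in D :\ B | #|B :&: B'| == s1]|
                 = 2 ^ m * (2 ^ m + 1) * (2 ^ (l - 1) - 1),
               #|[set B' in D :\ B | #|B :&: B'| == s2]|
                 = 2 ^ (2 * m) - 1 &
               #|[set B' in D :\ B | #|B :&: B'| == s3]|
                 = 2 ^ m * (2 ^ m - 1) * (2 ^ (l - 1) - 1)])].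
Proof.
have /andP[l_gt0 _] := hl.
split.
- exact: bent_code_design.
- exact: bent_code_SDP.
by move=> _; split; [apply: bent_code_block_meet | apply: bent_code_meet_numbers].
Qed.
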